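(* Let $R(q)=1-257q-257q^2+q^3$. For each of the six sequences $a_n,b_n,c_n,d_n,e_n,t_n$ the ordinary generating function has denominator exactly $R(q)$ (i.e. the displayed fraction is in lowest terms in $\mathbb Q[q]$). More precisely, $$\sum_{n\ge0}a_nq^n=\frac{1+2q-1091q^2}{R(q)},\qquad \sum_{n\ge0}b_nq^n=\frac{6-664q-3374q^2}{R(q)},$$ $$\sum_{n\ge0}c_nq^n=\frac{7-1000q-3711q^2}{R(q)},\qquad \sum_{n\ge0}d_nq^n=\frac{167-21376q-91015q^2}{R(q)},$$ $$\sum_{n\ge0}e_nq^n=\frac{326-41728q-177670q^2}{R(q)},\qquad \sum_{n\ge0}t_nq^n=\frac{340-43520q-185300q^2}{R(q)}.$$
   Context: Let $r_0=1,\ r_1=-5,\ r_{n+2}=16r_{n+1}+r_n$ and $s_0=0,\ s_1=2,\ s_{n+2}=16s_{n+1}+s_n$. For $n\ge0$ put $a_n=r_n^2-13r_ns_n+26s_n^2$, $b_n=6r_n^2+182s_n^2$, $c_n=7r_n^2+156s_n^2$, $d_n=167r_n^2+4342s_n^2$, $e_n=326r_n^2+8476s_n^2$, $t_n=340r_n^2+8840s_n^2$. *)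

(* Defs.v *)
From mathcomp Require Import all_boot all_order all_algebra.

Set Implicit Arguments.
Unset Strict Implicit.
Unset Printing Implicit Defensive.

Import Order.TTheory GRing.Theory Num.Theory.
Local Open Scope ring_scope.

(* The ring F[[q]], a series being its coefficient sequence; equality of series
   is equality of all coefficients (=1). *)
Definition fps (F : fieldType) : Type := nat -> F.

Definition fps_one (F : fieldType) : fps F := fun n => (n == 0%N)%:R.

Definition fps_mul (F : fieldType) (f g : fps F) : fps F :=
  fun n => \sum_(i < n.+1) f i * g (n - i)%N.

(* The first n + 1 coefficients of 1 / f, by the recursion
   g_0 = 1 / f_0,  g_n = - (1 / f_0) * sum_(i < n) f_(n - i) * g_i. *)
Fixpoint fps_inv_coefs (F : fieldType) (f : fps F) (n : nat) : seq F :=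
  if n is m.+1 then
    let s := fps_inv_coefs f m in
    rcons s (- (f 0%N)^-1 * \sum_(i < n) f (n - i)%N * s`_i)
  else [:: (f 0%N)^-1].

(* Meaningful only when f has a nonzero constant term; see fps_mulfV. *)
Definition fps_inv (F : fieldType) (f : fps F) : fps F :=
  fun n => (fps_inv_coefs f n)`_n.

Definition fps_div (F : fieldType) (f g : fps F) : fps F :=
  fps_mul f (fps_inv g).

Definition fps_of_poly (F : fieldType) (p : {poly F}) : fps F := fun n => p`_n.

Lemma size_fps_inv_coefs (F : fieldType) (f : fps F) (n : nat) :
  size (fps_inv_coefs f n) = n.+1.
Proof. by elim: n => //= n IHn; rewrite size_rcons IHn. Qed.

Lemma nth_fps_inv_coefs (F : fieldType) (f : fps F) (n i : nat) :
  (i <= n)%N -> (fps_inv_coefs f n)`_i = fps_inv f i.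
Proof.
elim: n => [|n IHn]; first by rewrite leqn0 => /eqP->.
rewrite leq_eqVlt ltnS => /predU1P[-> //|le_in].
by rewrite /= nth_rcons size_fps_inv_coefs ltnS le_in IHn.
Qed.

Lemma fps_mulfV (F : fieldType) (f : fps F) :
  f 0%N != 0 -> fps_mul f (fps_inv f) =1 fps_one F.
Proof.
move=> f0 [|n]; rewrite /fps_mul /fps_one.
  by rewrite big_ord1 /= subnn /fps_inv /= mulfV.
rewrite big_ord_recl /= subn0 [fps_inv f n.+1]/fps_inv /= nth_rcons.
rewrite size_fps_inv_coefs ltnn eqxx mulrA mulrN mulfV // mulN1r.
apply/eqP; rewrite addrC subr_eq0; apply/eqP.
rewrite (reindex_inj rev_ord_inj) /=; apply: eq_bigr => i _.
have le_in : (i <= n)%N by rewrite -ltnS.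
rewrite nth_fps_inv_coefs //.
by rewrite /bump /= !subSS add1n subKn // subSn.
Qed.

(* The series sum_n u_n q^n in Q[[q]]. *)
Definition ogf (u : nat -> int) : fps rat := fun n => (u n)%:~R.

(* The generating function of u is P / Q, and P / Q is in lowest terms in
   Q[q]. *)
Definition reduced_ogf (u : nat -> int) (P Q : {poly rat}) : Prop :=
  ogf u =1 fps_div (fps_of_poly P) (fps_of_poly Q) /\ coprimep P Q.

Fixpoint r_ (n : nat) : int :=
  match n with
  | 0%N => 1
  | n1.+1 => match n1 with
             | 0%N => - 5
             | n2.+1 => 16 * r_ n1 + r_ n2
             end
  end.

Fixpoint s_ (n : nat) : int :=
  match n with
  | 0%N => 0
  | n1.+1 => match n1 with
             | 0%N => 2
             | n2.+1 => 16 * s_ n1 + s_ n2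
             end
  end.

(* Large literals are written k%N%:R because ring_scope reads a bare literal
   in unary. *)
Definition a_ (n : nat) : int :=
  r_ n ^+ 2 - 13 * (r_ n * s_ n) + 26 * s_ n ^+ 2.
Definition b_ (n : nat) : int := 6 * r_ n ^+ 2 + 182 * s_ n ^+ 2.
Definition c_ (n : nat) : int := 7 * r_ n ^+ 2 + 156 * s_ n ^+ 2.
Definition d_ (n : nat) : int := 167 * r_ n ^+ 2 + 4342 * s_ n ^+ 2.
Definition e_ (n : nat) : int := 326 * r_ n ^+ 2 + 8476%N%:R * s_ n ^+ 2.
Definition t_ (n : nat) : int := 340 * r_ n ^+ 2 + 8840%N%:R * s_ n ^+ 2.

Definition Rq : {poly rat} := 1 - 257 *: 'X - 257 *: 'X^2 + 'X^3.

(* Main.v *)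
Require Import Defs.
From mathcomp Require Import all_boot all_order all_algebra.
From mathcomp Require Import ring lra.
Import GRing.Theory.
Local Open Scope ring_scope.

(** Every term of the six sequences is a fixed quadratic form evaluated at
    [(r_ n, s_ n)].  Both coordinates satisfy [x (n+2) = 16 x (n+1) + x n],
    whose characteristic roots [l, -1/l] satisfy [l - 1/l = 16]; hence products
    of two solutions are combinations of the powers of [l^2], [l^-2] and [-1],
    the reciprocal roots of [Rq = (1 + 'X) (1 - 258 'X + 'X^2)].  So each
    sequence satisfies the recurrence read off [Rq] ([rec_mul]), its generating
    function times [Rq] is a quadratic polynomial determined by three initial
    terms ([ogf_mul_Rq]), and dividing by the invertible series [Rq] gives the
    fraction ([fps_divI]).

    For the lowest terms, a quadratic [P] is coprime to [1 + 'X] as soon as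
    [P(-1) != 0], and modulo [1 - 258 'X + 'X^2] it reduces to a linear
    polynomial [u + v 'X], which is a unit there when its norm
    [u^2 + 258 u v + v^2] is nonzero ([coprimep_Rq]).  Both conditions are
    numerical. *)

(** * Division of power series *)

Lemma coef_fps_mul (F : fieldType) (f g : fps F) (N n : nat) : (n < N)%N ->
  fps_mul f g n = ((\poly_(i < N) f i) * (\poly_(i < N) g i))`_n.
Proof.
move=> lt_nN; rewrite coefM; apply: eq_bigr => i _; rewrite !coef_poly.
have le_in : (i <= n)%N by rewrite -ltnS.
by rewrite (leq_ltn_trans le_in lt_nN) (leq_ltn_trans (leq_subr _ _) lt_nN).
Qed.

(** The coefficients up to [n] of a product depend only on the truncations of
    the factors, so associativity is inherited from polynomials. *)
Lemma fps_mulA (F : fieldType) (f g h : fps F) :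
  fps_mul f (fps_mul g h) =1 fps_mul (fps_mul f g) h.
Proof.
move=> n; pose T (k : fps F) := \poly_(i < n.+1) k i.
have -> : fps_mul f (fps_mul g h) n = (T f * (T g * T h))`_n.
  rewrite coefM; apply: eq_bigr => i _.
  by rewrite coef_poly ltn_ord (@coef_fps_mul _ g h n.+1) // ltnS leq_subr.
rewrite mulrA coefM; apply: eq_bigr => i _.
by rewrite (@coef_fps_mul _ f g n.+1) // [(T h)`__]coef_poly ltnS leq_subr.
Qed.

Lemma fps_mul1 (F : fieldType) (f : fps F) : fps_mul f (@fps_one F) =1 f.
Proof.
move=> n; rewrite /fps_mul big_ord_recr /= subnn mulr1 big1 ?add0r // => i _.
by rewrite /fps_one subn_eq0 leqNgt ltn_ord mulr0.
Qed.

Lemma fps_divI (F : fieldType) (f g h : fps F) :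
  g 0%N != 0 -> fps_mul f g =1 h -> f =1 fps_div h g.
Proof.
move=> g0 fg_h n.
have -> : fps_div h g n = fps_mul (fps_mul f g) (fps_inv g) n.
  by apply: eq_bigr => i _; rewrite fg_h.
rewrite -fps_mulA -[LHS]fps_mul1.
by apply: eq_bigr => i _; rewrite fps_mulfV.
Qed.

(** * Generating functions with denominator [Rq] *)

Definition rec_Rq (u : nat -> int) : Prop :=
  forall n, u n.+3 = 257 * u n.+2 + 257 * u n.+1 - u n.

Lemma coef_Rq (n : nat) : Rq`_n =
  (n == 0)%:R - 257 * (n == 1)%:R - 257 * (n == 2)%:R + (n == 3)%:R.
Proof. by rewrite /Rq !coefE. Qed.

Lemma ogf_mul_Rq (u : nat -> int) : rec_Rq u ->
  fps_mul (ogf u) (fps_of_poly Rq) =1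
  fps_of_poly ((u 0)%:~R%:P + (u 1 - 257 * u 0)%:~R *: 'X
               + (u 2 - 257 * u 1 - 257 * u 0)%:~R *: 'X^2).
Proof.
move=> rec_u n; rewrite /fps_mul /fps_of_poly /ogf.
case: n => [|[|[|n]]].
- by rewrite big_ord1 coef_Rq !coefE /=; ring.
- by rewrite !big_ord_recr big_ord0 /= !coef_Rq !coefE /=; ring.
- by rewrite !big_ord_recr big_ord0 /= !coef_Rq !coefE /=; ring.
rewrite !big_ord_recr /= big1 ?add0r => [|i _].
  rewrite !subSS !subSn ?leqW // subnn !coef_Rq rec_u !coefE /=; ring.
have lt_in := ltn_ord i.
have lt3 : (3 < n.+3 - i)%N by rewrite ltn_subRL addn3 !ltnS.
by rewrite coef_Rq; case: (n.+3 - i)%N lt3 => [|[|[|[|m]]]] //= _; ring.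
Qed.

(** * Reducedness *)

Lemma Rq_factor : Rq = (1 + 'X) * (1 - 258 *: 'X + 'X^2).
Proof. rewrite /Rq -!mul_polyC; ring. Qed.

(** Write [D] for [1 - 258 'X + 'X^2].  The remainder of the polynomial modulo
    [D] is [u + v 'X] with [u = p0 - p2] and [v = p1 + 258 p2], and
    [v^2 D - (v 'X - 258 v - u) (u + v 'X) = u^2 + 258 u v + v^2]. *)
Lemma coprimep_Rq (p0 p1 p2 : rat) :
    p0 - p1 + p2 != 0 ->
    (p0 - p2) ^+ 2 + 258 * (p0 - p2) * (p1 + 258 * p2)
      + (p1 + 258 * p2) ^+ 2 != 0 ->
  coprimep (p0%:P + p1 *: 'X + p2 *: 'X^2) Rq.
Proof.
set P := _ + p2 *: 'X^2 => P_neg1 norm_neq0.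
rewrite Rq_factor coprimepMr; apply/andP; split.
  have -> : 1 + 'X = 'X - (- 1)%:P :> {poly rat} by rewrite polyCN opprK addrC.
  rewrite coprimep_XsubC /root /P !hornerE /=.
  by rewrite [X in X != 0](_ : _ = p0 - p1 + p2) //; ring.
set N := (X in X != 0) in norm_neq0.
apply/Bezout_eq1_coprimepP.
pose u := p0 - p2; pose v := p1 + 258 * p2.
pose L : {poly rat} := v%:P * 'X - (258 * v + u)%:P.
(* The term in [p2] absorbs the quotient [p2] of [P] by [D]. *)
exists (- N^-1%:P * L, N^-1%:P * ((v ^+ 2)%:P + p2%:P * L)) => /=.
transitivity (N^-1%:P * N%:P); last by rewrite -polyCM mulVf.
rewrite /N /L /P /u /v -!mul_polyC; ring.
Qed.

Lemma reduced_ogf_Rq (u : nat -> int) (p0 p1 p2 : rat) :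
    rec_Rq u ->
    [/\ (u 0)%:~R = p0, (u 1 - 257 * u 0)%:~R = - p1
      & (u 2 - 257 * u 1 - 257 * u 0)%:~R = - p2] ->
    p0 + p1 - p2 != 0 ->
    (p0 + p2) ^+ 2 - 258 * (p0 + p2) * (p1 + 258 * p2)
      + (p1 + 258 * p2) ^+ 2 != 0 ->
  reduced_ogf u (p0%:P - p1 *: 'X - p2 *: 'X^2) Rq.
Proof.
move=> rec_u [u0 u1 u2] P_neg1 norm_neq0; rewrite -!scaleNr; split.
  rewrite -u0 -u1 -u2; apply: fps_divI; last exact: ogf_mul_Rq.
  by rewrite /fps_of_poly coef_Rq.
apply: coprimep_Rq; first by rewrite opprK.
by rewrite [X in X != 0](_ : _ = (p0 + p2) ^+ 2
  - 258 * (p0 + p2) * (p1 + 258 * p2) + (p1 + 258 * p2) ^+ 2) //; ring.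
Qed.

(** * Quadratic forms in two solutions of the recurrence *)

(** With characteristic roots [l] and [-1/l] for both factors, the products
    have roots [l^2], [l^-2] and [-1]; since [l^2 + l^-2 = 16^2 + 2], their
    characteristic polynomial is [(z + 1) (z^2 - 258 z + 1)]. *)
Lemma rec_mul (x y : nat -> int) :
    (forall n, x n.+2 = 16 * x n.+1 + x n) ->
    (forall n, y n.+2 = 16 * y n.+1 + y n) ->
  rec_Rq (fun n => x n * y n).
Proof. by move=> rec_x rec_y n; rewrite !rec_x !rec_y; ring. Qed.

Lemma rec_quadratic_form (al be ga : int) (u : nat -> int) :
    (forall n, u n = al * (r_ n * r_ n) + be * (r_ n * s_ n)
                     + ga * (s_ n * s_ n)) ->
  rec_Rq u.
Proof.
move=> uE n; rewrite !uE.
have rr : rec_Rq (fun n => r_ n * r_ n) by apply: rec_mul.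
have rs : rec_Rq (fun n => r_ n * s_ n) by apply: rec_mul.
have ss : rec_Rq (fun n => s_ n * s_ n) by apply: rec_mul.
by rewrite rr rs ss; ring.
Qed.

(** * The six sequences *)

(** The numerator comes from the values [(1, 0)], [(-5, 2)], [(-79, 32)] of
    [(r_ n, s_ n)] for [n = 0, 1, 2]. *)
Lemma reduced_ogf_quadratic_form (al be ga : int) (u : nat -> int)
    (p0 p1 p2 : rat) :
    (forall n, u n = al * (r_ n * r_ n) + be * (r_ n * s_ n)
                     + ga * (s_ n * s_ n)) ->
    [/\ al%:~R = p0, (232 * al + 10 * be - 4 * ga)%:~R = p1
      & (441 * al - 42 * be + 4 * ga)%:~R = p2] ->
    p0 + p1 - p2 != 0 ->
    (p0 + p2) ^+ 2 - 258 * (p0 + p2) * (p1 + 258 * p2)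
      + (p1 + 258 * p2) ^+ 2 != 0 ->
  reduced_ogf u (p0%:P - p1 *: 'X - p2 *: 'X^2) Rq.
Proof.
move=> uE [<- <- <-]; apply: reduced_ogf_Rq.
  exact: rec_quadratic_form uE.
have r2 : r_ 2 = - 79 by [].
have s2 : s_ 2 = 32 by [].
by rewrite !uE r2 s2 /=; split; ring.
Qed.

Theorem theorem3p3 :
  reduced_ogf a_ (1 + 2 *: 'X - 1091 *: 'X^2) Rq /\
  reduced_ogf b_ (6%:P - 664 *: 'X - 3374 *: 'X^2) Rq /\
  reduced_ogf c_ (7%:P - 1000 *: 'X - 3711 *: 'X^2) Rq /\
  reduced_ogf d_ (167%:P - 21376%N%:R *: 'X - 91015%N%:R *: 'X^2) Rq /\
  reduced_ogf e_ (326%:P - 41728%N%:R *: 'X - 177670%N%:R *: 'X^2) Rq /\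
  reduced_ogf t_ (340%:P - 43520%N%:R *: 'X - 185300%N%:R *: 'X^2) Rq.
Proof.
have numE (p1 p2 : rat) : 1 + p1 *: 'X - p2 *: 'X^2 =
    1%:P - (- p1) *: 'X - p2 *: 'X^2.
  by rewrite scaleNr opprK polyC1.
split.
  rewrite (numE 2 1091).
  apply: (@reduced_ogf_quadratic_form 1 (- 13) 26).
  - move=> n; rewrite /a_; ring.
  - split; ring.
  - by apply: Num.Theory.ltr0_neq0; lra.
  - by apply: Num.Theory.ltr0_neq0; lra.
split.
  apply: (@reduced_ogf_quadratic_form 6 0 182).
  - move=> n; rewrite /b_; ring.
  - split; ring.
  - by apply: Num.Theory.ltr0_neq0; lra.
  - by apply: Num.Theory.ltr0_neq0; lra.
split.
  apply: (@reduced_ogf_quadratic_form 7 0 156).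
  - move=> n; rewrite /c_; ring.
  - split; ring.
  - by apply: Num.Theory.ltr0_neq0; lra.
  - by apply: Num.Theory.ltr0_neq0; lra.
split.
  apply: (@reduced_ogf_quadratic_form 167 0 4342).
  - move=> n; rewrite /d_; ring.
  - split; ring.
  - by apply: Num.Theory.ltr0_neq0; lra.
  - by apply: Num.Theory.ltr0_neq0; lra.
split.
  apply: (@reduced_ogf_quadratic_form 326 0 8476%N%:R).
  - move=> n; rewrite /e_; ring.
  - split; ring.
  - by apply: Num.Theory.ltr0_neq0; lra.
  - by apply: Num.Theory.ltr0_neq0; lra.
apply: (@reduced_ogf_quadratic_form 340 0 8840%N%:R).
- move=> n; rewrite /t_; ring.
- split; ring.
- by apply: Num.Theory.ltr0_neq0; lra.
- by apply: Num.Theory.ltr0_neq0; lra.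
Qed.
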